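(* Let $t_1,t_2,t_3\in\mathbb{R}$ be such that the points $e^{it_1},e^{it_2},e^{it_3}$ are distinct and lie on an arc of the unit circle of length at most $\arccos(1/8)$. Then $\mathrm{conv}\{\mathrm{SM}_6(t_1),\mathrm{SM}_6(t_2),\mathrm{SM}_6(t_3)\}$ is a 2-dimensional face of $\mathcal{B}_6$. Consequently, as $n\to\infty$, $$\frac{\mathrm{fmax}(6,n;2)}{\binom{n}{3}}\ \geq\ 3\left(\frac{\arccos(1/8)}{2\pi}\right)^2+o(1).$$
   Context: $\mathrm{SM}_6(t)=(\cos t,\sin t,\cos 3t,\sin 3t,\cos 5t,\sin 5t)\in\mathbb{R}^6$ and $\mathcal{B}_6=\mathrm{conv}\{\mathrm{SM}_6(t):t\in\mathbb{R}\}$. A face is the intersection with a supporting hyperplane. A polytope $P$ is centrally symmetric if $P=-P$; $\mathrm{fmax}(d,n;j)$ is the maximum number of $j$-dimensional faces of a centrally symmetric $d$-dimensional polytope with $n$ vertices, defined for those $n$ for which such polytopes exist, with asymptotics as $n\to\infty$ over such $n$. *)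

(* Defs.v *)
From HB Require Import structures.
From mathcomp Require Import all_boot all_order all_algebra.
From mathcomp Require Import all_classical all_reals all_analysis.
From mathcomp Require Import complex.

Set Implicit Arguments.
Unset Strict Implicit.
Unset Printing Implicit Defensive.

Import Order.TTheory GRing.Theory Num.Theory.
Import numFieldNormedType.Exports.

Local Open Scope classical_set_scope.
Local Open Scope card_scope.
Local Open Scope ring_scope.

Definition convex_hull (R : realType) (d : nat) (A : set 'rV[R]_d) :
    set 'rV[R]_d :=
  smallest (@convex_set R 'rV[R]_d) A.

Definition translate (R : realType) (d : nat) (x0 : 'rV[R]_d)
    (U : {vspace 'rV[R]_d}) : set 'rV[R]_d :=
  [set x0 + u | u in [set u | u \in U]].

Definition affine_subspace (R : realType) (d : nat) (A : set 'rV[R]_d) : Prop :=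
  exists x0 U, A = translate x0 U.

Definition affine_hull (R : realType) (d : nat) (A : set 'rV[R]_d) :
    set 'rV[R]_d :=
  smallest (@affine_subspace R d) A.

Definition has_dim (R : realType) (d : nat) (A : set 'rV[R]_d) (j : nat) : Prop :=
  exists x0 (U : {vspace 'rV[R]_d}),
    affine_hull A = translate x0 U /\ (\dim U)%VS = j.

Definition dotp (R : realType) (d : nat) (u v : 'rV[R]_d) : R :=
  \sum_i u 0 i * v 0 i.

(* [c] and [b] describe a hyperplane supporting [K]; nonemptiness of [F] says
   that the hyperplane touches [K]. *)
Definition is_face (R : realType) (d : nat) (K F : set 'rV[R]_d) : Prop :=
  exists (c : 'rV[R]_d) (b : R),
    [/\ c != 0,
        forall x, K x -> dotp c x <= b,
        F = K `&` [set x | dotp c x = b] &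
        F !=set0].

Definition polytope (R : realType) (d : nat) (P : set 'rV[R]_d) : Prop :=
  exists2 V : set 'rV[R]_d, finite_set V & P = convex_hull V.

Definition centrally_symmetric (R : realType) (d : nat) (P : set 'rV[R]_d) :
    Prop :=
  P = [set - x | x in P].

Definition vertices (R : realType) (d : nat) (P : set 'rV[R]_d) :
    set 'rV[R]_d :=
  [set v | is_face P [set v]].

Definition faces_of_dim (R : realType) (d : nat) (P : set 'rV[R]_d) (j : nat) :
    set (set 'rV[R]_d) :=
  [set F | is_face P F /\ has_dim F j].

(* The ambient space of a d-dimensional polytope is R^d. *)
Definition cs_polytope (R : realType) (d n : nat) (P : set 'rV[R]_d) : Prop :=
  [/\ polytope P, has_dim P d, centrally_symmetric P & vertices P #= `I_n].

(* The possible numbers of j-dimensional faces. *)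
Definition cs_face_numbers (R : realType) (d n j : nat) : set nat :=
  [set k | exists2 P : set 'rV[R]_d,
             cs_polytope n P & faces_of_dim P j #= `I_k].

(* Meaningful only when [exists P : set 'rV[R]_d, cs_polytope n P]; the default
   value of [xget] is irrelevant otherwise. *)
Definition fmax (R : realType) (d n j : nat) : nat :=
  xget 0%N [set m | cs_face_numbers R d n j m /\
                    forall k, cs_face_numbers R d n j k -> (k <= m)%N].

Definition SM6 (R : realType) (t : R) : 'rV[R]_6 :=
  \row_(k < 6) [:: cos t; sin t; cos (3 * t); sin (3 * t);
                   cos (5 * t); sin (5 * t)]`_k.

Definition B6 (R : realType) : set 'rV[R]_6 := convex_hull (range (@SM6 R)).
Arguments B6 : clear implicits.

(* e^(it) *)
Definition expi (R : realType) (t : R) : R[i] := Complex (cos t) (sin t).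

(* The arc of the unit circle traversed by e^(is) as s runs from a to b; its
   length is b - a as long as a <= b <= a + 2 * pi. *)
Definition circle_arc (R : realType) (a b : R) : set R[i] := @expi R @` `[a, b].

(* Main.v *)
(** A face with vertices [SM6 t1], [SM6 t2], [SM6 t3] is a trigonometric
    polynomial [f = K - sum over odd k <= 5 of (p_k cos kt + q_k sin kt)] that
    is nonnegative and vanishes only at the [t_i].  After a rotation the points
    are [e^(-ih), p, e^(ih)] with [p = a + ib], and with [C = 2 cos h] the
    polynomial is [f = (2 cos t - C)^2 (1 - Re (p^* e^(it))) G], where
    [y = C + p + e^(it)] and [G = |y|^4 - 4 (Im y)^2 + 2 C Re (y^2 p^* )]; this
    [G] ([triple_cofactor], with [y = A + iB]) is what cancels the even
    frequencies.  An arc of length at most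
    [acos (1/8)] means exactly [C >= 3/2], which makes [G] positive.

    For the count, [n] must be even, and the hull of [SM6] at the [n]-th roots
    of unity is a centrally symmetric polytope whose 2-faces include all triples
    within [q = floor (n acos (1/8) / (2 pi))] consecutive steps: there are
    [n * 'C(q, 2)] of them.  The maximum defining [fmax] exists because a face
    of a polytope is determined by the vertices that it contains. *)

Require Import Defs.
From HB Require Import structures.
From mathcomp Require Import all_boot all_order all_algebra.
From mathcomp Require Import all_classical all_reals all_analysis.
From mathcomp Require Import complex.
From mathcomp Require Import zify ring lra.

Set Implicit Arguments.
Unset Strict Implicit.
Unset Printing Implicit Defensive.

Import Order.TTheory GRing.Theory Num.Theory.
Import numFieldNormedType.Exports.

Local Open Scope classical_set_scope.
Local Open Scope card_scope.
Local Open Scope ring_scope.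

(** * Positivity of the cofactor of a triple *)

Section TriplePositivity.
Variable R : realType.
Implicit Types C a b x s : R.

Definition triple_cofactor C a b x s : R :=
  let A := C + a + x in let B := b + s in
  (A ^+ 2 + B ^+ 2) ^+ 2 - 4 * B ^+ 2 +
  2 * C * (a * (A ^+ 2 - B ^+ 2) + 2 * b * A * B).

(** With [x = cos t] and [s = sin t], the factors [4 x^3 - 3 x], [s (4 x^2 - 1)] and their quintic
    analogues are the third and fifth harmonics. Besides the constant, only odd harmonics occur, so
    the product is a constant plus a linear functional evaluated on the curve. *)
Lemma triple_cofactor_expansion C a b x s :
  a ^+ 2 + b ^+ 2 = 1 -> x ^+ 2 + s ^+ 2 = 1 ->
  let D := 4 * a ^+ 2 + 6 * a * C + C ^+ 2 in
  let E := 3 * C + 2 * a in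
  (2 * x - C) ^+ 2 * (1 - a * x - b * s) * triple_cofactor C a b x s =
  (C * (C + 2 * a)) ^+ 3
  + ((10 * E - a * D * (4 + C ^+ 4) - 15 * C ^+ 3 - 10 * C ^+ 4 * a) * x
     - b * D * (C ^+ 4 - 2 * C ^+ 2 + 2) * s
     + (5 * E + a * D * (2 * C ^+ 2 - 3) - 5 * C ^+ 3) * (4 * x ^+ 3 - 3 * x)
     + b * D * (2 * C ^+ 2 - 3) * (s * (4 * x ^+ 2 - 1))
     + (E - a * D) * (16 * x ^+ 5 - 20 * x ^+ 3 + 5 * x)
     - b * D * (s * (16 * x ^+ 4 - 12 * x ^+ 2 + 1))).
Proof.
move=> hb hs D E; rewrite /D /E /triple_cofactor.
have hb' : b ^+ 2 = 1 - a ^+ 2 by rewrite -hb; ring.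
have hs' : s ^+ 2 = 1 - x ^+ 2 by rewrite -hs; ring.
ring: hb' hs'.
Qed.

(** Completing a square bounds the cofactor below by [(A^2 + B^2)^2 - 8 B^2], which is positive if
    [A^2 > 2] or if [B] is small. In the remaining range [x] is close to [-1], and the sign of [b B]
    decides. *)
Lemma triple_cofactor_gt0 C a b x s :
  a ^+ 2 + b ^+ 2 = 1 -> x ^+ 2 + s ^+ 2 = 1 ->
  3 / 2 <= C -> C <= 2 -> C <= 2 * a -> 0 < triple_cofactor C a b x s.
Proof.
move=> hb hs C1 C2 aC.
have a3 : 3 / 4 <= a by lra.
have bx : b ^+ 2 <= 7 / 16 by move: hb a3; clear; nra.
have a1 : a <= 1 by nra.
have x1 : -1 <= x by nra.
rewrite /triple_cofactor; set A := C + a + x; set B := b + s; cbv zeta.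
have C0 : 0 <= C by lra.
have a0 : 0 <= a by lra.
have AE : A = C + a + x by [].
have BE : B = b + s by [].
clearbody A B.
have A1 : 5 / 4 <= A by rewrite AE; lra.
(* Since [a^2 + b^2 = 1], [a (A^2 - B^2) + 2 b A B = ((a A + b B)^2 - B^2) / a]. The coefficient
   [2 - C / a] is nonnegative because [C <= 2 a]. *)
have sqE : (A ^+ 2 + B ^+ 2) ^+ 2 - 4 * B ^+ 2 +
    2 * C * (a * (A ^+ 2 - B ^+ 2) + 2 * b * A * B) =
    ((A ^+ 2 + B ^+ 2) ^+ 2 - 8 * B ^+ 2) +
    2 * C * (a * A + b * B) ^+ 2 / a + 2 * (2 - C / a) * B ^+ 2.
  have a_neq0 : a != 0 by apply/eqP; lra.
  have hb' : b ^+ 2 = 1 - a ^+ 2 by rewrite -hb; ring.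
  by field: hb'.
have bound : 0 < (A ^+ 2 + B ^+ 2) ^+ 2 - 8 * B ^+ 2 ->
    0 < (A ^+ 2 + B ^+ 2) ^+ 2 - 4 * B ^+ 2 +
    2 * C * (a * (A ^+ 2 - B ^+ 2) + 2 * b * A * B).
  move=> h; rewrite sqE; apply: ltr_wpDr.
    apply: mulr_ge0; last exact: sqr_ge0.
    by rewrite mulr_ge0// subr_ge0 ler_pdivrMr; lra.
  apply: ltr_wpDr => //; apply: divr_ge0; last lra.
  by apply: mulr_ge0; [lra|exact: sqr_ge0].
clear sqE.
have B0 : 0 <= B ^+ 2 by exact: sqr_ge0.
have [A2|A2] := ltP 2 (A ^+ 2).
  apply: bound.
  have : 0 <= (B ^+ 2 - 2) ^+ 2 by exact: sqr_ge0.
  by move: A2 B0; move: (A ^+ 2) (B ^+ 2) => u v; clear; nra.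
(* The constant is slightly above [sqrt 2]; as [C + a >= 9 / 4], it forces [x] towards [-1] and
   makes [s^2] small. *)
have A3 : A <= 14143 / 10000 by move: A1 A2; move: (A) => u; clear; nra.
have x0 : x <= - (8357 / 10000) by move: A3; rewrite AE; lra.
have sx : s ^+ 2 <= 31 / 100 by move: hs x0; clear; nra.
have uA : 25 / 16 <= A ^+ 2 by move: A1; move: (A) => u; clear; nra.
have [bB|bB] := leP 0 (b * B).
  have BA : B ^+ 2 <= 3 / 2.
    (* The weights 5 and 6 balance [b^2 <= 7 / 16] against [s^2 <= 31 / 100], which keeps [B^2]
       below [25 / 16 <= A^2]. *)
    have : 0 <= (5 * b - 6 * s) ^+ 2 by exact: sqr_ge0.
    by rewrite BE; move: sx bx; clear; nra.
  have Ca : 0 <= C * a * (A ^+ 2 - B ^+ 2).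
    by rewrite mulr_ge0 ?mulr_ge0 ?subr_ge0//; move: BA uA; clear; lra.
  have CbB : 0 <= C * A * (b * B).
    by apply: mulr_ge0 => //; apply: mulr_ge0 => //; move: A1; clear; lra.
  have e : (A ^+ 2 + B ^+ 2) ^+ 2 - 4 * B ^+ 2 +
      2 * C * (a * (A ^+ 2 - B ^+ 2) + 2 * b * A * B) =
    ((A ^+ 2 + B ^+ 2) ^+ 2 - 4 * B ^+ 2) +
    (2 * (C * a * (A ^+ 2 - B ^+ 2)) + 4 * (C * A * (b * B))) by ring.
  suff : 0 < (A ^+ 2 + B ^+ 2) ^+ 2 - 4 * B ^+ 2.
    by rewrite e => h; rewrite ltr_wpDr// addr_ge0// mulr_ge0.
  by move: B0 BA uA; move: (A ^+ 2) (B ^+ 2) => u v; clear; nra.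
(* From [B^2 = b B + s B] and [b B < 0] follows [B^2 <= s B], so [B] is no larger than [s] in
   absolute value. *)
have Bs : B ^+ 2 <= s ^+ 2.
  have e : B ^+ 2 = b * B + s * B by rewrite -mulrDl -BE expr2.
  have : 0 <= (B - s) ^+ 2 by exact: sqr_ge0.
  by move: e bB; clear; lra.
apply: bound.
have := le_trans Bs sx.
by move: uA B0; move: (A ^+ 2) (B ^+ 2) => u v; clear; nra.
Qed.

End TriplePositivity.

(** * Convex hulls and their faces *)

Section ConvexHulls.
Variables (R : realType) (d : nat).
Implicit Types (A B F K V : set 'rV[R]_d) (b k : R) (c u v x y : 'rV[R]_d).

Lemma convex_setE A : @convex_set R 'rV[R]_d A <->
  forall x y k, A x -> A y -> 0 <= k -> k <= 1 -> A (k *: x + (1 - k) *: y).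
Proof.
split=> [cA x y k Ax Ay k0 k1|cA x y k /set_mem Ax /set_mem Ay].
  by have := cA x y (Itv01 k0 k1) (mem_set Ax) (mem_set Ay); rewrite inE.
by rewrite inE; exact: cA.
Qed.

Lemma convex_hull_sub A : A `<=` convex_hull A.
Proof. exact: sub_gen_smallest. Qed.

Lemma convex_hull_convex A x y k : convex_hull A x -> convex_hull A y ->
  0 <= k -> k <= 1 -> convex_hull A (k *: x + (1 - k) *: y).
Proof.
move=> hx hy k0 k1 B [cB AB].
by apply/(convex_setE B).1 => //; [exact: hx|exact: hy].
Qed.

Lemma convex_hull_min A B :
  (forall x y k, B x -> B y -> 0 <= k -> k <= 1 -> B (k *: x + (1 - k) *: y)) ->
  A `<=` B -> convex_hull A `<=` B.
Proof. by move=> cB AB; apply: smallest_sub => //; apply/convex_setE. Qed.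

Lemma convex_hullS A B : A `<=` B -> convex_hull A `<=` convex_hull B.
Proof.
move=> AB; apply: convex_hull_min; first exact: convex_hull_convex.
by apply: subset_trans AB _; exact: convex_hull_sub.
Qed.

Lemma convex_hull1 v : convex_hull [set v] = [set v].
Proof.
apply/seteqP; split; last exact: convex_hull_sub.
apply: convex_hull_min => // x y k /= -> -> _ _.
by rewrite -scalerDl addrC subrK scale1r.
Qed.

Lemma convex_hull_neq0 A : convex_hull A !=set0 -> A !=set0.
Proof.
move=> [x hx]; apply/set0P/negP => /eqP A0.
suff : set0 x by [].
by apply: (convex_hull_min _ _ hx); rewrite ?A0.
Qed.

Lemma convex_hull_opp A :
  convex_hull [set - x | x in A] = [set - x | x in convex_hull A].
Proof.
have sub B : convex_hull [set - x | x in B] `<=` [set - x | x in convex_hull B].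
  apply: convex_hull_min => [x y k [x' hx' <-] [y' hy' <-] k0 k1|_ [x Bx <-]].
    exists (k *: x' + (1 - k) *: y'); first exact: convex_hull_convex.
    by rewrite opprD !scalerN.
  by exists x => //; exact: convex_hull_sub.
apply/seteqP; split; first exact: sub.
move=> _ [x hx <-].
have : convex_hull [set - y | y in [set - y | y in A]] x.
  by apply: convex_hullS hx => y Ay; exists (- y); [exists y|rewrite opprK].
by move=> /sub[y hy <-]; rewrite opprK.
Qed.

Lemma dotpDr c x y : dotp c (x + y) = dotp c x + dotp c y.
Proof. by rewrite -big_split/=; apply: eq_bigr => i _; rewrite mxE mulrDr. Qed.

Lemma dotpZr c k x : dotp c (k *: x) = k * dotp c x.
Proof. by rewrite mulr_sumr; apply: eq_bigr => i _; rewrite mxE mulrCA. Qed.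

Lemma dotpC c x : dotp c x = dotp x c.
Proof. by apply: eq_bigr => i _; rewrite mulrC. Qed.

Lemma dotpNr c x : dotp c (- x) = - dotp c x.
Proof. by rewrite -scaleN1r dotpZr mulN1r. Qed.

Lemma dotpDl c c' x : dotp (c + c') x = dotp c x + dotp c' x.
Proof. by rewrite dotpC dotpDr !(dotpC x). Qed.

Lemma dotpZl k c x : dotp (k *: c) x = k * dotp c x.
Proof. by rewrite dotpC dotpZr dotpC. Qed.

Lemma dotp0l x : dotp 0 x = 0.
Proof. by rewrite /dotp big1// => i _; rewrite mxE mul0r. Qed.

Lemma dotp_ge0 x : 0 <= dotp x x.
Proof. by apply: sumr_ge0 => i _; rewrite -expr2 sqr_ge0. Qed.

Lemma dotp_eq0 x : (dotp x x == 0) = (x == 0).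
Proof.
apply/idP/eqP => [|->]; last by rewrite dotp0l.
rewrite psumr_eq0 => [/allP h|i _]; last by rewrite -expr2 sqr_ge0.
apply/rowP => i; rewrite mxE; apply/eqP.
by have := h i (mem_index_enum i); rewrite /= -expr2 sqrf_eq0.
Qed.

Lemma dotp_hull_le c b A : (forall x, A x -> dotp c x <= b) ->
  forall x, convex_hull A x -> dotp c x <= b.
Proof.
move=> cA; apply: convex_hull_min => // x y k hx hy k0 k1.
by rewrite dotpDr !dotpZr; nra.
Qed.

(* The points of the hull which lie on the hyperplane only if they belong to
   the hull of [A `&` H] form a convex set containing [A]. *)
Lemma convex_hull_face c b A : (forall x, A x -> dotp c x <= b) ->
  convex_hull A `&` [set x | dotp c x = b] =
  convex_hull (A `&` [set x | dotp c x = b]).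
Proof.
move=> cA; apply/seteqP; split => [x [hx xb]|x hx]; last first.
  split; first by apply: convex_hullS hx => y [].
  apply: (convex_hull_min _ _ hx) => [y z k yb zb _ _|y []//].
  by rewrite /= dotpDr !dotpZr yb zb; ring.
pose B := [set x | dotp c x <= b /\
  (dotp c x = b -> convex_hull (A `&` [set x | dotp c x = b]) x)].
suff /(_ x hx)[_ /(_ xb)//] : convex_hull A `<=` B.
apply: convex_hull_min => [y z k [y1 y2] [z1 z2] k0 k1|y Ay]; last first.
  by split => [|yb]; [exact: cA|exact: convex_hull_sub].
rewrite /B /= dotpDr !dotpZr; split; first by nra.
have [->|k_neq0] := eqVneq k 0.
  by rewrite mul0r add0r subr0 mul1r scale0r add0r scale1r.
have [->|k_neq1] := eqVneq k 1.
  by rewrite subrr mul0r addr0 mul1r scale0r addr0 scale1r.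
have k0' : 0 < k by rewrite lt_def k_neq0.
have k1' : k < 1 by rewrite lt_def eq_sym k_neq1.
move=> e; apply: convex_hull_convex => //.
  by apply: y2; apply/eqP; rewrite eq_le y1/=; nra.
by apply: z2; apply/eqP; rewrite eq_le z1/=; nra.
Qed.

(** By [convex_hull_face] a face is spanned by the generators on its hyperplane, so questions about
    faces of a polytope reduce to a finite set. *)
Lemma is_face_hull A F : is_face (convex_hull A) F ->
  exists c b, [/\ c != 0, forall x, A x -> dotp c x <= b,
    F = convex_hull (A `&` [set x | dotp c x = b]) &
    A `&` [set x | dotp c x = b] !=set0].
Proof.
move=> [c [b [c0 cA FE F0]]]; exists c, b.
have cA' x : A x -> dotp c x <= b by move=> /convex_hull_sub; exact: cA.
rewrite convex_hull_face// in FE; split => //.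
by apply: convex_hull_neq0; rewrite -FE.
Qed.

Lemma hull_is_face A c b : c != 0 -> (forall x, A x -> dotp c x <= b) ->
  A `&` [set x | dotp c x = b] !=set0 ->
  is_face (convex_hull A) (convex_hull (A `&` [set x | dotp c x = b])).
Proof.
move=> c0 cA [x Hx]; exists c, b; split => //.
- exact: dotp_hull_le.
- by rewrite convex_hull_face.
- by exists x; exact: convex_hull_sub.
Qed.

End ConvexHulls.

(** * Faces are determined by their vertices *)

Lemma card_eq_II_le_fintype (U : pointedType) (T : finType) (A : set U) k
    (f : U -> T) : {in A &, injective f} -> A #= `I_k -> (k <= #|T|)%N.
Proof.
move=> injf /card_esym /card_set_bijP[g [fung injg _]].
have inj : injective (fun i : 'I_k => f (g i)).
  move=> i j fij; apply/val_inj/injg; rewrite ?inE /=; [exact: ltn_ord..|].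
  by apply: injf; rewrite ?inE//; apply: fung; exact: ltn_ord.
by have := leq_card _ inj; rewrite card_ord.
Qed.

Lemma fintype_le_card_eq_II (U : Type) (T : finType) (D : {set T}) (A : set U) k
    (f : T -> U) : {in D &, injective f} -> (forall t, t \in D -> A (f t)) ->
  A #= `I_k -> (#|D| <= k)%N.
Proof.
move=> injf Af /card_set_bijP[g [fung injg _]].
have gk t : t \in D -> (g (f t) < k)%N by move=> /Af /fung.
case: k => [|k] in fung injg gk *.
  rewrite leqn0 cards_eq0; apply/eqP/setP => t; rewrite inE.
  by apply/negP => /gk.
rewrite -[leqRHS]card_ord.
have inj : {in D &, injective (fun t => inord (g (f t)) : 'I_k.+1)}.
  move=> t u Dt Du /(congr1 val) /=; rewrite !inordK ?gk// => e.
  by apply: injf => //; apply: injg; rewrite ?inE//; exact: Af.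
by rewrite -(card_in_imset inj) max_card.
Qed.

Lemma finite_set_inj_fintype (U : Type) (T : finType) (A : set U) (f : U -> T) :
  {in A &, injective f} -> finite_set A.
Proof.
move=> injf; rewrite -(eq_finite_set (inj_card_eq injf)).
exact: finite_finset.
Qed.

Lemma finite_argmax (R : realType) (T : eqType) (A : set T) (f : T -> R) :
  finite_set A -> A !=set0 -> exists2 u, A u & forall x, A x -> f x <= f u.
Proof.
move=> /finite_seqP[s ->]; elim: s => [[x]//|y s IH _] /=.
have [s0|s0] := eqVneq s [::].
  by exists y; rewrite s0 /= ?mem_head// => x; rewrite /= inE => /eqP ->.
have [z zs] : [set` s] !=set0.
  by case: s s0 {IH} => // z s _; exists z; rewrite /= mem_head.
have [u us ux] := IH (ex_intro _ z zs).
have [yu|uy] := leP (f y) (f u).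
  exists u; rewrite /= ?inE ?us ?orbT// => x /=.
  by rewrite inE => /orP[/eqP ->|/ux].
exists y; rewrite /= ?mem_head// => x /=; rewrite inE => /orP[/eqP ->//|/ux].
by move/le_trans; apply; exact: ltW.
Qed.

Section FacesVertices.
Variables (R : realType) (d : nat).
Implicit Types (P F V : set 'rV[R]_d) (b e : R) (c u v x y : 'rV[R]_d).

(** Points off the hyperplane have a positive gap to it, and finitely many gaps survive a small
    tilt. On the hyperplane itself [c'] alone decides. *)
Lemma perturbed_support V c b c' b' : finite_set V ->
  (forall x, V x -> dotp c x <= b) ->
  (forall x, V x -> dotp c x = b -> dotp c' x <= b') ->
  exists e : R, forall x, V x ->
    dotp (c + e *: c') x <= b + e * b' /\
    (dotp (c + e *: c') x = b + e * b' <-> dotp c x = b /\ dotp c' x = b').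
Proof.
move=> /finite_seqP[s ->] hb hb'.
(* All small positive [e] are treated at once, so that the induction can shrink the threshold. *)
suff [e0 e00 he0] : exists2 e0, 0 < e0 & forall e, 0 < e -> e < e0 ->
    forall x, x \in s ->
    dotp (c + e *: c') x <= b + e * b' /\
    (dotp (c + e *: c') x = b + e * b' <-> dotp c x = b /\ dotp c' x = b').
  by exists (e0 / 2) => x /= xs; apply: he0 => //; lra.
elim: s hb hb' => [_ _|y s IH hb hb']; first by exists 1.
have [||e0 e00 he0] := IH.
- by move=> x /= xs; apply: hb; rewrite /= inE xs orbT.
- by move=> x /= xs; apply: hb'; rewrite /= inE xs orbT.
have hy := hb y (mem_head y s); have hy' := hb' y (mem_head y s).
have [yb|yb] := eqVneq (dotp c y) b.
  exists e0 => // e e_gt0 ee0 x; rewrite inE => /orP[/eqP ->|]; last exact: he0.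
  have := hy' yb; rewrite dotpDl dotpZl yb lerD2l ler_pM2l// => h.
  split=> //; split=> [|[_ ->]//] /addrI /mulfI h'; split => //.
  by apply: h'; rewrite gt_eqF.
have gap : 0 < b - dotp c y by rewrite subr_gt0 lt_neqAle yb.
have q0 : 0 < (b - dotp c y) / (`|dotp c' y - b'| + 1).
  by rewrite divr_gt0// ltr_wpDl.
(* Below this threshold the tilt moves [y] by less than its gap; the [+ 1] keeps the denominator
   positive. *)
exists (Num.min e0 ((b - dotp c y) / (`|dotp c' y - b'| + 1))).
  by rewrite lt_min e00.
move=> e e_gt0; rewrite lt_min => /andP[ee0 eq0] x.
rewrite inE => /orP[/eqP ->|]; last exact: he0.
suff : dotp (c + e *: c') y < b + e * b'.
  move=> lt; split; first exact: ltW.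
  by split=> [e1|[e1]]; [rewrite e1 ltxx in lt|rewrite e1 eqxx in yb].
rewrite ltr_pdivlMr in eq0; last by rewrite ltr_wpDl.
rewrite dotpDl dotpZl.
have : e * (dotp c' y - b') <= e * `|dotp c' y - b'|.
  by rewrite ler_pM2l// ler_norm.
by move: eq0; rewrite mulrDr mulr1 mulrBr; lra.
Qed.

(* If [F] is not contained in [F'], tilt the normal of [F] away from [F'] to
   expose a subface of [F] disjoint from [F']; a point of maximal norm in that
   subface is a vertex. *)
Lemma face_sub_of_vertices P F F' : polytope P -> is_face P F -> is_face P F' ->
  vertices P `&` F `<=` F' -> F `<=` F'.
Proof.
move=> [V finV ->] /is_face_hull[c [b [_ hc -> [w0 [Vw0 w0b]]]]].
move=> /is_face_hull[c' [b' [c'0 hc' -> [z [Vz zb']]]]] sub.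
apply: convex_hull_min => [|w [Vw wb]]; first exact: convex_hull_convex.
apply: contrapT => wF'.
have [v [Vv vb] vmin] : exists2 v, (V `&` [set x | dotp c x = b]) v &
    forall x, (V `&` [set x | dotp c x = b]) x -> - dotp c' x <= - dotp c' v.
  by apply: finite_argmax; [exact: finite_setIl|exists w].
set m := dotp c' v.
have mb' : m < b'.
  apply: (@le_lt_trans _ _ (dotp c' w)); first by rewrite -lerN2 vmin.
  rewrite lt_neqAle hc'// andbT; apply/eqP => wb'.
  by apply: wF'; apply: convex_hull_sub.
have [u [[Vu ub] um] umax] : exists2 u,
    (V `&` [set x | dotp c x = b] `&` [set x | dotp c' x = m]) u &
    forall x, (V `&` [set x | dotp c x = b] `&` [set x | dotp c' x = m]) x ->
      dotp x x <= dotp u u.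
  apply: finite_argmax; last by exists v.
  by apply: finite_setIl; exact: finite_setIl.
(* The first tilt selects the generators of [F] at which [c'] takes its minimum [m]. *)
have [|e1 h1] := @perturbed_support V c b (-1 *: c') (- m) finV hc.
  by move=> x Vx xb; rewrite dotpZl mulN1r; exact: vmin.
have uux x : dotp (u - x) (u - x) = dotp u u - 2 * dotp u x + dotp x x.
  rewrite dotpDr !dotpNr dotpC !(dotpC _ x) !dotpDr !dotpNr (dotpC x u).
  by ring.
(* The second tilt is towards [u]. If [|x| <= |u|], then [0 <= |u - x|^2] gives
   [dotp u x <= dotp u u], with equality only at [x = u]. *)
have [| |e2 h2] := @perturbed_support V (c + e1 *: (-1 *: c')) (b + e1 * - m)
    u (dotp u u) finV.
- by move=> x /h1[].
- move=> x Vx /(h1 x Vx).2[xb]; rewrite dotpZl mulN1r => /oppr_inj xm.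
  have : dotp x x <= dotp u u by apply: umax.
  by have := dotp_ge0 (u - x); rewrite uux; lra.
set c2 := _ + e2 *: u in h2; set b2 := _ + e2 * _ in h2.
have exposed x : V x -> dotp c2 x = b2 ->
    [/\ dotp c x = b, dotp c' x = m & x = u].
  move=> Vx /(h2 x Vx).2[/(h1 x Vx).2[xb]].
  rewrite dotpZl mulN1r => /oppr_inj xm ux; split => //.
  have : dotp x x <= dotp u u by apply: umax.
  move=> xu; apply/esym/subr0_eq/eqP; rewrite -dotp_eq0 eq_le dotp_ge0 andbT.
  by rewrite uux ux; lra.
have ub2 : dotp c2 u = b2.
  apply/(h2 u Vu).2; split => //; apply/(h1 u Vu).2; split => //.
  by rewrite dotpZl mulN1r um.
(* A vanishing normal would expose every generator, including [z], where [c'] takes the value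
   [b' > m]. *)
have c20 : c2 != 0.
  apply/eqP => c20; have [//|_ zm _] := exposed z Vz _.
    by rewrite -ub2 c20 !dotp0l.
  by rewrite -zm zb' ltxx in mb'.
have vu : vertices (convex_hull V) u.
  rewrite /vertices /=.
  suff <- : convex_hull (V `&` [set x | dotp c2 x = b2]) = [set u].
    apply: hull_is_face => //; first by move=> x /h2[].
    by exists u.
  rewrite -[RHS]convex_hull1; congr convex_hull; apply/seteqP; split.
    by move=> x [Vx /(exposed x Vx)[]].
  by move=> _ ->.
have : convex_hull (V `&` [set x | dotp c' x = b']) u.
  by apply: sub; split => //; apply: convex_hull_sub.
by rewrite -convex_hull_face// => -[_ /= ub']; rewrite -um ub' ltxx in mb'.
Qed.

Lemma face_eq_of_vertices P F F' : polytope P -> is_face P F -> is_face P F' ->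
  vertices P `&` F = vertices P `&` F' -> F = F'.
Proof.
move=> pP fF fF' e; apply/seteqP; split; apply: (face_sub_of_vertices pP) => //.
  by rewrite e; exact: subIsetr.
by rewrite -e; exact: subIsetr.
Qed.

(** A face is encoded by the indices of its vertices. Counting subsets of ['I_n] then yields both
    finiteness and the bound [2 ^ n]. *)
Lemma faces_of_dim_inj P n j : polytope P -> vertices P #= `I_n ->
  exists f : set 'rV[R]_d -> {set 'I_n},
    {in faces_of_dim P j &, injective f}.
Proof.
move=> pP /card_esym /card_set_bijP[g [_ _ surjg]].
exists (fun F => [set i : 'I_n | g i \in F]%SET) => F F'.
rewrite !inE => -[fF _] [fF' _] /setP e; apply: (face_eq_of_vertices pP) => //.
apply/seteqP; split => x [] vx Fx; split => //.
  have [i ni gi] := surjg x vx; have := e (Ordinal ni).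
  by rewrite !inE /= gi (mem_set Fx) => /esym /set_mem.
have [i ni gi] := surjg x vx; have := e (Ordinal ni).
by rewrite !inE /= gi (mem_set Fx) => /set_mem.
Qed.

Lemma cs_face_numbers_bounded n j k :
  cs_face_numbers R d n j k -> (k <= 2 ^ n)%N.
Proof.
move=> [P [pP _ _ vP] fP]; have [f injf] := faces_of_dim_inj j pP vP.
have := card_eq_II_le_fintype injf fP.
by rewrite -cardsT -powersetT card_powerset cardsT card_ord.
Qed.

Lemma cs_polytope_faces_finite n j P : cs_polytope n P ->
  exists k, faces_of_dim P j #= `I_k.
Proof.
move=> [pP _ _ vP]; have [f injf] := faces_of_dim_inj j pP vP.
exact: finite_set_inj_fintype injf.
Qed.

(** The bound [2 ^ n] is uniform over all polytopes, so a maximum exists and [xget] returns it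
    instead of its default. *)
Lemma leq_fmax n j k : cs_face_numbers R d n j k -> (k <= fmax R d n j)%N.
Proof.
move=> hk.
pose p := fun m => `[< cs_face_numbers R d n j m >].
have exp : exists m, p m by exists k; apply/asboolP.
have ubp m : p m -> (m <= 2 ^ n)%N.
  by move=> /asboolP; exact: cs_face_numbers_bounded.
have [m /asboolP pm maxm] := ex_maxnP exp ubp.
rewrite /fmax; case: xgetP => [l _ [_ /(_ _ hk)]//|/(_ m)[]].
by split => // i hi; apply: maxm; apply/asboolP.
Qed.

End FacesVertices.

(** * The symmetric moment curve *)

Section SymmetricMomentCurve.
Variable R : realType.
Implicit Types t u r : R.

Lemma cos3E t : cos (3 * t) = 4 * cos t ^+ 3 - 3 * cos t.
Proof.
have hs := sin2cos2 t.
have -> : 3 * t = t *+ 2 + t by ring.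
by rewrite cosD cos_mulr2n sin_mulr2n; ring: hs.
Qed.

Lemma sin3E t : sin (3 * t) = sin t * (4 * cos t ^+ 2 - 1).
Proof.
have -> : 3 * t = t *+ 2 + t by ring.
by rewrite sinD cos_mulr2n sin_mulr2n; ring.
Qed.

Lemma cos5E t : cos (5 * t) = 16 * cos t ^+ 5 - 20 * cos t ^+ 3 + 5 * cos t.
Proof.
have hs := sin2cos2 t.
have -> : 5 * t = 3 * t + t *+ 2 by ring.
by rewrite cosD cos3E sin3E cos_mulr2n sin_mulr2n; ring: hs.
Qed.

Lemma sin5E t : sin (5 * t) = sin t * (16 * cos t ^+ 4 - 12 * cos t ^+ 2 + 1).
Proof.
have -> : 5 * t = 3 * t + t *+ 2 by ring.
by rewrite sinD cos3E sin3E cos_mulr2n sin_mulr2n; ring.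
Qed.

Lemma dotp_SM6 (c : 'rV[R]_6) t : dotp c (SM6 t) =
  c 0 (inord 0) * cos t + c 0 (inord 1) * sin t +
  c 0 (inord 2) * cos (3 * t) + c 0 (inord 3) * sin (3 * t) +
  c 0 (inord 4) * cos (5 * t) + c 0 (inord 5) * sin (5 * t).
Proof.
rewrite /dotp !big_ord_recr big_ord0 /= !mxE /= add0r.
by do ![congr (_ + _)]; congr (c _ _ * _); apply/val_inj; rewrite /= inordK.
Qed.

(** The multiple-angle formulas express the last four coordinates through the first two. *)
Lemma SM6E t u : SM6 t = SM6 u <-> cos t = cos u /\ sin t = sin u.
Proof.
split=> [e|[ec es]].
  by split; [have := congr1 (fun M : 'rV_6 => M 0 (inord 0)) e
            |have := congr1 (fun M : 'rV_6 => M 0 (inord 1)) e];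
     rewrite !mxE inordK.
by rewrite /SM6 !cos3E !sin3E !cos5E !sin5E ec es.
Qed.

Lemma expi_eq t u : expi t = expi u <-> SM6 t = SM6 u.
Proof. by rewrite SM6E; split=> [[-> ->]|[ec es]]//; rewrite /expi ec es. Qed.

Lemma SM6_shift t u r :
  cos (t - r) = cos (u - r) -> sin (t - r) = sin (u - r) -> SM6 t = SM6 u.
Proof.
move=> ec es; apply/SM6E.
rewrite -(subrK r t) -(subrK r u) (cosD (t - r)) (sinD (t - r)) ec es.
by rewrite -cosD -sinD.
Qed.

(** All frequencies are odd, so a half turn negates every coordinate. *)
Lemma SM6Dpi t : SM6 (t + pi) = - SM6 t.
Proof.
have ec : cos (t + pi) = - cos t := cosDpi t.
have es : sin (t + pi) = - sin t := sinDpi t.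
apply/rowP => k; rewrite !mxE !cos3E !sin3E !cos5E !sin5E ec es.
by case: k => -[|[|[|[|[|[|//]]]]]] /= _; ring.
Qed.

(** Rotations of the circle act linearly on the curve, so a functional may be designed in
    coordinates centred at [r]. *)
Lemma shifted_functional (p1 q1 p3 q3 p5 q5 r : R) :
  exists c : 'rV[R]_6, forall t, dotp c (SM6 t) =
    p1 * cos (t - r) + q1 * sin (t - r) +
    p3 * cos (3 * (t - r)) + q3 * sin (3 * (t - r)) +
    p5 * cos (5 * (t - r)) + q5 * sin (5 * (t - r)).
Proof.
exists (\row_(k < 6)
  [:: p1 * cos r - q1 * sin r; p1 * sin r + q1 * cos r;
      p3 * cos (3 * r) - q3 * sin (3 * r); p3 * sin (3 * r) + q3 * cos (3 * r);
      p5 * cos (5 * r) - q5 * sin (5 * r);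
      p5 * sin (5 * r) + q5 * cos (5 * r)]`_k) => t.
by rewrite dotp_SM6 !mxE !inordK//= !mulrBr !cosB !sinB; ring.
Qed.

(** This is where [1 / 8] enters: by the double-angle formula it equals [2 (3 / 4)^2 - 1]. *)
Lemma cos_half_acos (h : R) : 0 <= h -> 2 * h <= acos (1 / 8) -> 3 / 4 <= cos h.
Proof.
move=> h0 hacos.
have b8 : -1 <= (1 / 8 : R) <= 1 by apply/andP; split; lra.
have pi0 := pi_gt0 R; have acospi := acos_lepi b8.
have c2h : 1 / 8 <= cos (2 * h).
  rewrite -[leLHS]acosK ?in_itv//= leNgt ltr_cos ?in_itv/= -?leNgt//; lra.
have ch : 0 <= cos h by apply: cos_ge0_pihalf; apply/andP; split; lra.
have : cos (2 * h) = 2 * cos h ^+ 2 - 1.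
  by rewrite mulr_natl cos_mulr2n; ring.
by move: c2h ch; move: (cos (2 * h)) (cos h) => y x; clear; nra.
Qed.

(** Twice [1 - a x - b s] is the squared distance of the unit vectors [(a, b)] and [(x, s)]. *)
Lemma unit_dot_le1 (a b x s : R) : a ^+ 2 + b ^+ 2 = 1 -> x ^+ 2 + s ^+ 2 = 1 ->
  0 <= 1 - a * x - b * s /\ (1 - a * x - b * s = 0 -> x = a /\ s = b).
Proof.
move=> hb hs.
have e : 2 * (1 - a * x - b * s) = (x - a) ^+ 2 + (s - b) ^+ 2.
  have hb' : b ^+ 2 = 1 - a ^+ 2 by rewrite -hb; ring.
  have hs' : s ^+ 2 = 1 - x ^+ 2 by rewrite -hs; ring.
  by ring: hb' hs'.
have xa := sqr_ge0 (x - a); have sb := sqr_ge0 (s - b).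
split=> [|h0]; first lra.
by split; apply/subr0_eq/eqP; rewrite -sqrf_eq0 eq_le ?xa ?sb andbT; lra.
Qed.

(** The functional is read off from [triple_cofactor_expansion]. The parameters may coincide, so the
    same statement also exposes single points of the curve. *)
Lemma SM6_triple_support (r1 r2 r3 : R) : r1 <= r2 -> r2 <= r3 ->
  r3 - r1 <= acos (1 / 8) ->
  exists (c : 'rV[R]_6) (b : R), [/\ c != 0,
    forall t, dotp c (SM6 t) <= b &
    forall t, dotp c (SM6 t) = b <->
      [\/ SM6 t = SM6 r1, SM6 t = SM6 r2 | SM6 t = SM6 r3]].
Proof.
move=> r12 r23 r13.
(* Rotating by the midpoint [tau] puts the outer points at the angles [- h] and [h]. *)
pose tau := (r1 + r3) / 2; pose h := (r3 - r1) / 2.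
have r1E : r1 - tau = - h by rewrite /tau /h; field.
have r3E : r3 - tau = h by rewrite /tau /h; field.
have h0 : 0 <= h by rewrite /h; lra.
have ch : 3 / 4 <= cos h by apply: cos_half_acos => //; rewrite /h; lra.
pose C := 2 * cos h; pose a := cos (r2 - tau); pose b := sin (r2 - tau).
have b8 : -1 <= (1 / 8 : R) <= 1 by apply/andP; split; lra.
(* The middle point satisfies [|r2 - tau| <= h], and the cosine is even and decreasing on
   [[0, pi]]. *)
have aC : C <= 2 * a.
  rewrite /C ler_pM2l//.
  have acospi := acos_lepi b8.
  have hpi : h <= pi by rewrite /h; have := pi_gt0 R; lra.
  have mh : `|r2 - tau| <= h.
    by rewrite ler_norml /h /tau; apply/andP; split; lra.
  rewrite /a -(cos_norm (r2 - tau)) leNgt ltr_cos ?in_itv/= -?leNgt//.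
    by rewrite h0.
  by rewrite normr_ge0 (le_trans mh).
have hb : a ^+ 2 + b ^+ 2 = 1 := cos2Dsin2 (r2 - tau).
have C1 : 3 / 2 <= C by rewrite /C; lra.
have C2 : C <= 2 by have := cos_le1 h; rewrite /C; lra.
pose f t := (2 * cos (t - tau) - C) ^+ 2 *
  (1 - a * cos (t - tau) - b * sin (t - tau)) *
  triple_cofactor C a b (cos (t - tau)) (sin (t - tau)).
pose D := 4 * a ^+ 2 + 6 * a * C + C ^+ 2; pose E := 3 * C + 2 * a.
have [c cE] := shifted_functional
  (- (10 * E - a * D * (4 + C ^+ 4) - 15 * C ^+ 3 - 10 * C ^+ 4 * a))
  (b * D * (C ^+ 4 - 2 * C ^+ 2 + 2))
  (- (5 * E + a * D * (2 * C ^+ 2 - 3) - 5 * C ^+ 3))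
  (- (b * D * (2 * C ^+ 2 - 3)))
  (- (E - a * D)) (b * D) tau.
pose K := (C * (C + 2 * a)) ^+ 3.
have fE t : f t = K - dotp c (SM6 t).
  rewrite cE /f triple_cofactor_expansion ?cos2Dsin2// cos3E sin3E cos5E sin5E.
  by rewrite -/D -/E -/K; ring.
have G0 t : 0 < triple_cofactor C a b (cos (t - tau)) (sin (t - tau)).
  by apply: triple_cofactor_gt0 => //; exact: cos2Dsin2.
have f0 t : 0 <= f t.
  apply: mulr_ge0; last exact: ltW.
  apply: mulr_ge0; first exact: sqr_ge0.
  by case: (unit_dot_le1 hb (cos2Dsin2 (t - tau))).
have fz t : f t = 0 <-> [\/ SM6 t = SM6 r1, SM6 t = SM6 r2 | SM6 t = SM6 r3].
  split; last first.
    case=> /SM6E[ec es]; rewrite /f !cosB !sinB ec es -!cosB -!sinB.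
    - by rewrite r1E cosN /C subrr expr0n/= !mul0r.
    - by rewrite -/a -/b -!expr2 -addrA -opprD hb subrr mulr0 mul0r.
    - by rewrite r3E /C subrr expr0n/= !mul0r.
  rewrite /f => /eqP; rewrite mulf_eq0 (gt_eqF (G0 t)) orbF mulf_eq0 sqrf_eq0.
  case/orP=> /eqP; last first.
    by case: (unit_dot_le1 hb (cos2Dsin2 (t - tau))) => _ /[apply] -[xa sb];
      apply: Or32; apply: SM6_shift xa sb.
  (* A zero of the squared factor fixes the cosine, hence the sine up to sign: these are the two
     outer points. *)
  move=> xC; have ec : cos (t - tau) = cos h by move: xC; rewrite /C; lra.
  have : sin (t - tau) ^+ 2 = sin h ^+ 2 by rewrite !sin2cos2 ec.
  move=> /eqP; rewrite eqf_sqr => /orP[]/eqP es.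
    by apply: Or33; apply: (@SM6_shift _ _ tau); rewrite r3E.
  by apply: Or31; apply: (@SM6_shift _ _ tau); rewrite r1E ?cosN ?sinN.
exists c, K; split => [|t|t].
(* With [c = 0] the function [f] would be the constant [K > 0], yet it vanishes at [r1]. *)
- apply/eqP => c0; have K0 : K = 0.
    have /fz := Or31 (SM6 r1 = SM6 r2) (SM6 r1 = SM6 r3) (erefl (SM6 r1)).
    by rewrite fE c0 dotp0l subr0.
  have := gt_eqF (exprn_gt0 3 (_ : 0 < C * (C + 2 * a))).
  by rewrite -/K K0 eqxx => /(_ ltac:(nra)).
- by have := f0 t; rewrite fE subr_ge0.
- rewrite -fz fE; split=> [->|/subr0_eq//]; exact: subrr.
Qed.

End SymmetricMomentCurve.

(** * Triangular faces from short arcs *)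

Lemma affine_hull_min (R : realType) (d : nat) (A B : set 'rV[R]_d) :
  affine_subspace B -> A `<=` B -> affine_hull A `<=` B.
Proof. exact: smallest_sub. Qed.

(** Any affine subspace through the three points has [q - p] and [r - p] among its directions, so
    the affine hull is [p] plus their span. *)
Lemma has_dim_triangle (R : realType) (d : nat) (p q r : 'rV[R]_d) :
  free [:: q - p; r - p] -> has_dim (convex_hull [set p; q; r]) 2.
Proof.
move=> free2; pose U := <<[:: q - p; r - p]>>%VS.
have Uq : q - p \in U by apply: memv_span; rewrite mem_head.
have Ur : r - p \in U by apply: memv_span; rewrite !inE eqxx orbT.
exists p, U; split; last exact/eqP.
apply/seteqP; split.
  apply: affine_hull_min; first by exists p, U.
  apply: convex_hull_min => [_ _ k [x Ux <-] [y Uy <-] _ _|x].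
    exists (k *: x + (1 - k) *: y); first by rewrite /= memvD ?memvZ.
    by rewrite !scalerDr addrACA -scalerDl subrKC scale1r.
  case=> [[->|->]|->]; first by exists 0; rewrite ?addr0//= mem0v.
  - by exists (q - p); rewrite ?subrKC.
  - by exists (r - p); rewrite ?subrKC.
move=> _ [u Uu <-] B [[x0 [W ->]] sub].
have mem x : x \in [set p; q; r] -> exists2 w, w \in W & x0 + w = x.
  by rewrite inE => xA; have [w ? ?] := sub x (convex_hull_sub xA); exists w.
have [|wp Wp pE] := mem p; first by rewrite inE; left; left.
have [|wq Wq qE] := mem q; first by rewrite inE; left; right.
have [|wr Wr rE] := mem r; first by rewrite inE; right.
exists (wp + u); last by rewrite addrA pE.
rewrite /= memvD//; apply: subvP Uu; apply/span_subvP => x.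
rewrite !inE => /orP[]/eqP ->.
  by rewrite -qE -pE opprD addrACA subrr add0r memvB.
by rewrite -rE -pE opprD addrACA subrr add0r memvB.
Qed.

Section ShortArcs.
Variable R : realType.
Implicit Types t u r : R.

(** Proportional differences would put three points [z1, z2, z3] of the unit circle on a line. Their
    unit norms then give [k (k - 1) |z3 - z1|^2 = 0], so two of them coincide. *)
Lemma SM6_free t1 t2 t3 : SM6 t1 != SM6 t2 -> SM6 t1 != SM6 t3 ->
  SM6 t2 != SM6 t3 -> free [:: SM6 t2 - SM6 t1; SM6 t3 - SM6 t1].
Proof.
move=> n12 n13 n23; rewrite free_cons seq1_free subr_eq0 eq_sym n13 andbT.
rewrite span_seq1; apply/negP => /vlineP[k e].
have ec : cos t2 - cos t1 = k * (cos t3 - cos t1).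
  by have := congr1 (fun M : 'rV_6 => M 0 (inord 0)) e; rewrite !mxE inordK.
have es : sin t2 - sin t1 = k * (sin t3 - sin t1).
  by have := congr1 (fun M : 'rV_6 => M 0 (inord 1)) e; rewrite !mxE inordK.
have h1 := cos2Dsin2 t1; have h2 := cos2Dsin2 t2; have h3 := cos2Dsin2 t3.
have c2 : cos t2 = cos t1 + k * (cos t3 - cos t1) by rewrite -ec; ring.
have s2 : sin t2 = sin t1 + k * (sin t3 - sin t1) by rewrite -es; ring.
have : k * (k - 1) * ((cos t3 - cos t1) ^+ 2 + (sin t3 - sin t1) ^+ 2) = 0.
  have s1' : sin t1 ^+ 2 = 1 - cos t1 ^+ 2 by rewrite -h1; ring.
  have s3' : sin t3 ^+ 2 = 1 - cos t3 ^+ 2 by rewrite -h3; ring.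
  transitivity (cos t2 ^+ 2 + sin t2 ^+ 2 - 1); last by rewrite h2 subrr.
  by rewrite c2 s2; ring: s1' s3'.
move/eqP; rewrite mulf_eq0 mulf_eq0 => /orP[/orP[]|].
- move=> /eqP k0; move/eqP: n12; apply; apply/esym/SM6E.
  by rewrite c2 s2 k0 !mul0r !addr0.
- rewrite subr_eq0 => /eqP k1; move/eqP: n23; apply; apply/SM6E.
  by rewrite c2 s2 k1 !mul1r !subrKC.
- rewrite paddr_eq0 ?sqr_ge0// !sqrf_eq0 !subr_eq0 => /andP[/eqP c3 /eqP s3].
  by move/eqP: n13; apply; apply/esym/SM6E.
Qed.

Lemma short_arc_support t1 t2 t3 :
  (exists a b : R, [/\ a <= b, b - a <= acos (1 / 8) &
     [set expi t1; expi t2; expi t3] `<=` circle_arc a b]) ->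
  exists (c : 'rV[R]_6) (b : R), [/\ c != 0,
    forall t, dotp c (SM6 t) <= b &
    forall t, dotp c (SM6 t) = b <->
      [\/ SM6 t = SM6 t1, SM6 t = SM6 t2 | SM6 t = SM6 t3]].
Proof.
move=> [a [b [ab bphi sub]]].
(* [SM6 t] depends only on [expi t], so each parameter may be replaced by one in [[a, b]]. *)
have rep t : [set expi t1; expi t2; expi t3] (expi t) ->
    exists r, [/\ a <= r, r <= b & SM6 t = SM6 r].
  by move=> /sub[r]; rewrite /= in_itv/= => /andP[ar rb] /expi_eq rt; exists r.
have [|r1 [a1 b1 ->]] := rep t1; first by left; left.
have [|r2 [a2 b2 ->]] := rep t2; first by left; right.
have [|r3 [a3 b3 ->]] := rep t3; first by right.
have supp x y z : a <= x -> x <= y -> y <= z -> z <= b ->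
    (forall t, [\/ SM6 t = SM6 x, SM6 t = SM6 y | SM6 t = SM6 z] <->
      [\/ SM6 t = SM6 r1, SM6 t = SM6 r2 | SM6 t = SM6 r3]) ->
    exists (c : 'rV[R]_6) (k : R), [/\ c != 0,
      forall t, dotp c (SM6 t) <= k &
      forall t, dotp c (SM6 t) = k <->
        [\/ SM6 t = SM6 r1, SM6 t = SM6 r2 | SM6 t = SM6 r3]].
  move=> ax xy yz zb e.
  have [|c [k [c0 ck cE]]] := SM6_triple_support xy yz; first by lra.
  by exists c, k; split=> // t; rewrite cE.
(* The claim is symmetric in the three points, so the parameters are sorted. *)
have [le12|/ltW le21] := leP r1 r2; have [le23|/ltW le32] := leP r2 r3;
  have [le13|/ltW le31] := leP r1 r3.
- exact: (supp r1 r2 r3).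
- exact: (supp r1 r2 r3).
- by apply: (supp r1 r3 r2) => // t;
    split=> -[]; by [apply: Or31|apply: Or32|apply: Or33].
- by apply: (supp r3 r1 r2) => // t;
    split=> -[]; by [apply: Or31|apply: Or32|apply: Or33].
- by apply: (supp r2 r1 r3) => // t;
    split=> -[]; by [apply: Or31|apply: Or32|apply: Or33].
- by apply: (supp r2 r3 r1) => // t;
    split=> -[]; by [apply: Or31|apply: Or32|apply: Or33].
- by apply: (supp r3 r2 r1) => // t;
    split=> -[]; by [apply: Or31|apply: Or32|apply: Or33].
- by apply: (supp r3 r2 r1) => // t;
    split=> -[]; by [apply: Or31|apply: Or32|apply: Or33].
Qed.

(** Allowing any [V] between the triple and the whole curve covers both [B6] and the regular
    polytope. *)
Lemma short_arc_face t1 t2 t3 (V : set 'rV[R]_6) :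
  (exists a b : R, [/\ a <= b, b - a <= acos (1 / 8) &
     [set expi t1; expi t2; expi t3] `<=` circle_arc a b]) ->
  V `<=` range (@SM6 R) -> [set SM6 t1; SM6 t2; SM6 t3] `<=` V ->
  is_face (convex_hull V) (convex_hull [set SM6 t1; SM6 t2; SM6 t3]).
Proof.
move=> /short_arc_support[c [b [c0 cb cE]]] VS TV.
have e : V `&` [set x | dotp c x = b] = [set SM6 t1; SM6 t2; SM6 t3].
  apply/seteqP; split => [x [/VS[t _ <-] /= /cE[] ->]|x Tx].
  - by left; left.
  - by left; right.
  - by right.
  split; first exact: TV.
  by case: Tx => [[]|] ->; apply/cE; [apply: Or31|apply: Or32|apply: Or33].
rewrite -e; apply: hull_is_face => //; first by move=> x /VS[t _ <-].
by rewrite e; exists (SM6 t1); left; left.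
Qed.

Lemma short_arc_triangle t1 t2 t3 :
  [/\ expi t1 != expi t2, expi t1 != expi t3 & expi t2 != expi t3] ->
  has_dim (convex_hull [set SM6 t1; SM6 t2; SM6 t3]) 2.
Proof.
move=> [n12 n13 n23]; apply/has_dim_triangle/SM6_free.
- by apply: contra_neq n12 => /expi_eq.
- by apply: contra_neq n13 => /expi_eq.
- by apply: contra_neq n23 => /expi_eq.
Qed.

End ShortArcs.

(** * The regular polytope on the moment curve *)

Section TrigonometricSums.
Variable R : realType.
Implicit Types p q x y z : R.

(* Applying [h |-> h (i+2) + h i - 2 cos(y) h (i+1)] kills the frequency [y];
   doing so for [y] and [z] isolates the frequency [x]. *)
Lemma trig_sum_eq0 (p1 q1 p2 q2 p3 q3 x y z : R) :
  cos x != cos y -> cos x != cos z -> sin x != 0 ->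
  (forall i : nat, p1 * cos (i%:R * x) + q1 * sin (i%:R * x) +
     p2 * cos (i%:R * y) + q2 * sin (i%:R * y) +
     p3 * cos (i%:R * z) + q3 * sin (i%:R * z) = 0) ->
  p1 = 0 /\ q1 = 0.
Proof.
move=> xy xz sx0 h.
have cosS (i : nat) (t : R) :
    cos (i.+1%:R * t) = cos (i%:R * t) * cos t - sin (i%:R * t) * sin t.
  by rewrite -cosD; congr cos; rewrite -natr1; ring.
have sinS (i : nat) (t : R) :
    sin (i.+1%:R * t) = sin (i%:R * t) * cos t + cos (i%:R * t) * sin t.
  by rewrite -sinD; congr sin; rewrite -natr1; ring.
(* Eliminating [z] multiplies a frequency [w] by [2 (cos w - cos z)]; the result is normalised at
   [x]. *)
have h1 (i : nat) : p1 * cos (i.+1%:R * x) + q1 * sin (i.+1%:R * x) +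
    (cos y - cos z) / (cos x - cos z) *
    (p2 * cos (i.+1%:R * y) + q2 * sin (i.+1%:R * y)) = 0.
  have e0 := h i; have e1 := h i.+1; have e2 := h i.+2.
  have cx0 : cos x - cos z != 0 by rewrite subr_eq0.
  apply: (mulfI (_ : 2 * (cos x - cos z) != 0)).
    by rewrite mulf_neq0// pnatr_eq0.
  have sX := sin2cos2 x; have sY := sin2cos2 y; have sZ := sin2cos2 z.
  rewrite mulr0 -[RHS](_ : 0 + 0 - 2 * cos z * 0 = 0); last by ring.
  rewrite -{1}e2 -{1}e0 -e1 !(cosS, sinS).
  by field: sX sY sZ.
have h2 (i : nat) : p1 * cos (i.+2%:R * x) + q1 * sin (i.+2%:R * x) = 0.
  have e0 := h1 i; have e1 := h1 i.+1; have e2 := h1 i.+2.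
  have cx0 : cos x - cos y != 0 by rewrite subr_eq0.
  apply: (mulfI (_ : 2 * (cos x - cos y) != 0)).
    by rewrite mulf_neq0// pnatr_eq0.
  have sX := sin2cos2 x; have sY := sin2cos2 y.
  rewrite mulr0 -[RHS](_ : 0 + 0 - 2 * cos y * 0 = 0); last by ring.
  rewrite -{1}e2 -{1}e0 -e1.
  move: (_ / _) => w; rewrite !(cosS, sinS).
  by ring: sX sY.
(* The equations at [2 x] and [3 x] form a linear system for [p1] and [q1] with determinant
   [sin x]. *)
have := h2 1%N; rewrite (cosS 2%N) (sinS 2%N).
have := h2 0%N; move: (cos2Dsin2 (2%:R * x)).
move: (cos (2%:R * x)) (sin (2%:R * x)) => u v uv e0 e1.
have {}e1 : q1 * u - p1 * v = 0.
  apply: (mulfI sx0); rewrite mulr0.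
  transitivity (p1 * (u * cos x - v * sin x) + q1 * (v * cos x + u * sin x) -
    cos x * (p1 * u + q1 * v)); first by ring.
  by rewrite e1 e0 mulr0 subr0.
split.
  transitivity (u * (p1 * u + q1 * v) - v * (q1 * u - p1 * v)).
    by rewrite -[LHS]mulr1 -uv; ring.
  by rewrite e0 e1 !mulr0 subr0.
transitivity (v * (p1 * u + q1 * v) + u * (q1 * u - p1 * v)).
  by rewrite -[LHS]mulr1 -uv; ring.
by rewrite e0 e1 !mulr0 addr0.
Qed.

End TrigonometricSums.

Section RegularPolytope.
Variables (R : realType) (n : nat).

(** The index runs through all naturals and wraps around with period [n], so sums of indices need no
    reduction. *)
Definition vtx (i : nat) : 'rV[R]_6 := SM6 (2 * pi * i%:R / n%:R).

Lemma vtx_add (i j : nat) : (0 < n)%N -> vtx (i + j * n) = vtx i.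
Proof.
move=> n0; have nR : n%:R != 0 :> R by rewrite pnatr_eq0 -lt0n.
elim: j => [|j IH]; first by rewrite mul0n addn0.
rewrite -IH mulSn addnCA; apply/SM6E.
have -> : 2 * pi * (n + (i + j * n))%:R / n%:R =
    2 * pi * (i + j * n)%:R / n%:R + pi *+ 2 :> R.
  by rewrite natrD; field.
by split; [exact: cosD2pi|exact: sinD2pi].
Qed.

Lemma vtx_mod i : (0 < n)%N -> vtx i = vtx (i %% n).
Proof. by move=> n0; rewrite {1}(divn_eq i n) addnC vtx_add. Qed.

Lemma SM6_inj_period (t u : R) :
  t <= u -> u < t + 2 * pi -> SM6 t = SM6 u -> t = u.
Proof.
move=> tu ut /SM6E[ec es].
have c1 : cos (u - t) = 1 by rewrite cosB ec es -!expr2 cos2Dsin2.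
apply/eqP; rewrite eq_le tu/=; rewrite leNgt; apply/negP => lt.
(* At the half angle [0 < v < pi], hence [cos (u - t) = 1 - 2 sin(v)^2 < 1]. *)
pose v := (u - t) / 2; have vE : u - t = v *+ 2 by rewrite /v; field.
have s0 : 0 < sin v by apply: sin_gt0_pi; apply/andP; split; rewrite /v; lra.
move: c1; rewrite vE cos_mulr2n cos2sin2.
by move: s0; move: (sin v) => s; clear; nra.
Qed.

Lemma vtx_eq i j : (0 < n)%N -> vtx i = vtx j <-> i = j %[mod n].
Proof.
move=> n0; split; last by move=> e; rewrite vtx_mod// e -vtx_mod.
rewrite (vtx_mod i)// (vtx_mod j)//.
have : (i %% n < n)%N by rewrite ltn_mod.
have : (j %% n < n)%N by rewrite ltn_mod.
move: (i %% n)%N (j %% n)%N => {}i {}j.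
have nR : 0 < n%:R :> R by rewrite ltr0n.
wlog ij : i j / (i <= j)%N.
  move=> wl jn i_n; case/orP: (leq_total i j) => h; first exact: wl.
  by move=> /esym e; apply/esym/wl.
move=> jn _ /SM6_inj_period => e.
have := pi_gt0 R => pi0.
have {}e : 2 * pi * i%:R / n%:R = 2 * pi * j%:R / n%:R :> R.
  apply: e.
    by rewrite ler_pM2r ?invr_gt0// ler_pM2l ?ler_nat// mulr_gt0.
  apply: (@lt_le_trans _ _ (2 * pi * n%:R / n%:R)).
    by rewrite ltr_pM2r ?invr_gt0// ltr_pM2l ?ltr_nat// mulr_gt0.
  rewrite mulfK ?gt_eqF// lerDr divr_ge0// !mulr_ge0//; exact: ltW.
move/(divIf (lt0r_neq0 nR)): e => /(mulfI _) e.
by apply/eqP; rewrite -(eqr_nat R) e// gt_eqF// mulr_gt0.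
Qed.

Lemma vtx_opp i : (0 < n)%N -> ~~ odd n -> vtx (i + n./2) = - vtx i.
Proof.
move=> n0 evn; rewrite -SM6Dpi; congr SM6.
have nR : n%:R != 0 :> R by rewrite pnatr_eq0 -lt0n.
have n2 : n%:R = 2 * (n./2)%:R :> R.
  by rewrite -natrM mul2n; congr _%:R; rewrite even_halfK.
rewrite natrD mulrDr mulrDl; congr (_ + _).
by apply: (mulIf nR); rewrite divfK// n2; ring.
Qed.

(** For [d = 2 pi / n], having [n > 10] means [5 d < pi]. Then [d], [3 d] and [5 d] have distinct
    cosines and nonzero sines, and [trig_sum_eq0] isolates each frequency in turn. *)
Lemma vtx_dotp_eq0 (c : 'rV[R]_6) : (11 <= n)%N ->
  (forall i, dotp c (vtx i) = 0) -> c = 0.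
Proof.
move=> n11 h; pose d : R := 2 * pi / n%:R.
have pi0 := pi_gt0 R.
have nR : 0 < n%:R :> R by rewrite ltr0n (leq_trans _ n11).
have d0 : 0 < d by rewrite divr_gt0// mulr_gt0.
have d5 : 5 * d < pi.
  rewrite /d mulrA ltr_pdivrMr//.
  have : 11%:R <= n%:R :> R by rewrite ler_nat.
  by nra.
have cne (k l : R) : 0 <= k -> k <= 5 -> 0 <= l -> l <= 5 -> k != l ->
    cos (k * d) != cos (l * d).
  move=> k0 k5 l0 l5; apply: contra_neq => /cos_inj e.
  apply: (mulIf (lt0r_neq0 d0)).
  by apply: e; rewrite in_itv/=; apply/andP; split; nra.
have sne (k : R) : 0 < k -> k <= 5 -> sin (k * d) != 0.
  by move=> k0 k5; rewrite gt_eqF// sin_gt0_pi//; apply/andP; split; nra.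
have h' (i : nat) :
  c 0 (inord 0) * cos (i%:R * (1 * d)) + c 0 (inord 1) * sin (i%:R * (1 * d)) +
  c 0 (inord 2) * cos (i%:R * (3 * d)) + c 0 (inord 3) * sin (i%:R * (3 * d)) +
  c 0 (inord 4) * cos (i%:R * (5 * d)) + c 0 (inord 5) * sin (i%:R * (5 * d))
  = 0.
  rewrite -(h i) /vtx dotp_SM6 -/d.
  have e (k : R) : i%:R * (k * d) = k * (2 * pi * i%:R / n%:R).
    by rewrite /d; ring.
  by rewrite !e mul1r.
have [|||p1 q1] := trig_sum_eq0 _ _ _ h';
  try by [apply: cne; lra|apply: sne; lra].
have [|||i|p3 q3] := @trig_sum_eq0 R (c 0 (inord 2)) (c 0 (inord 3))
  (c 0 (inord 0)) (c 0 (inord 1)) (c 0 (inord 4)) (c 0 (inord 5))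
  (3 * d) (1 * d) (5 * d); try by [apply: cne; lra|apply: sne; lra].
  by rewrite -[RHS](h' i); ring.
have [|||i|p5 q5] := @trig_sum_eq0 R (c 0 (inord 4)) (c 0 (inord 5))
  (c 0 (inord 0)) (c 0 (inord 1)) (c 0 (inord 2)) (c 0 (inord 3))
  (5 * d) (1 * d) (3 * d); try by [apply: cne; lra|apply: sne; lra].
  by rewrite -[RHS](h' i); ring.
apply/rowP => k; rewrite mxE -[k]inord_val.
by case: k => -[|[|[|[|[|[|//]]]]]].
Qed.

(** No nonzero vector is orthogonal to all [vtx i], so the matrix with these rows has rank 6. *)
Lemma vtx_span (x : 'rV[R]_6) (U : {vspace 'rV[R]_6}) : (11 <= n)%N ->
  (forall i, vtx i \in U) -> x \in U.
Proof.
move=> n11 hU; pose M := \matrix_(i < n) vtx i.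
have n0 : (0 < n)%N by apply: leq_trans n11.
have : row_free M^T.
  rewrite -kermx_eq0; apply/eqP/row_matrixP => k; rewrite row0.
  have /sub_kermxP : (row k (kermx M^T) <= kermx M^T)%MS by exact: row_sub.
  set c := row k _ => cM; apply: vtx_dotp_eq0 => // i.
  rewrite vtx_mod//; pose j := Ordinal (ltn_pmod i n0).
  have /rowP /(_ j) := cM; rewrite !mxE => <-.
  by apply: eq_bigr => l _; rewrite !mxE.
rewrite /row_free mxrank_tr => fullM.
have /submxP[D ->] : (x <= M)%MS by apply: submx_full.
rewrite mulmx_sum_row; apply: memv_suml => k _; rewrite memvZ// rowK; exact: hU.
Qed.

Definition regular_polytope : set 'rV[R]_6 := convex_hull (range vtx).

Lemma range_vtx_opp : (0 < n)%N -> ~~ odd n ->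
  range vtx = [set - x | x in range vtx].
Proof.
move=> n0 evn; apply/seteqP; split => [_ [i _ <-]|_ [_ [i _ <-] <-]].
  exists (- vtx i); last by rewrite opprK.
  by exists (i + n./2)%N => //; exact: vtx_opp.
by exists (i + n./2)%N => //; exact: vtx_opp.
Qed.

Lemma range_vtx_finite : (0 < n)%N -> finite_set (range vtx).
Proof.
move=> n0; apply: (@sub_finite_set _ _ (vtx @` `I_n)).
  move=> _ [i _ <-].
  by exists (i %% n)%N; [rewrite /= ltn_mod|rewrite -vtx_mod].
by apply: finite_image; exact: finite_II.
Qed.

Lemma range_vtx_SM6 : range vtx `<=` range (@SM6 R).
Proof. by move=> _ [i _ <-]; eexists. Qed.

(** A vertex, being a face of a hull, contains a generator and so equals it. Conversely, each
    generator is the face of a degenerate triple on an arc of length 0. *)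
Lemma regular_polytope_vertices : (0 < n)%N ->
  vertices regular_polytope = range vtx.
Proof.
move=> n0; apply/seteqP; split => [v vv|_ [i _ <-]].
  have [c [b [_ _ e [w [Vw wb]]]]] := is_face_hull vv.
  suff -> : v = w by [].
  have : convex_hull (range vtx `&` [set x | dotp c x = b]) w.
    exact: convex_hull_sub.
  by rewrite -e => /= ->.
rewrite /vertices /=; pose t : R := 2 * pi * i%:R / n%:R.
have e (x : 'rV[R]_6) : [set x; x; x] = [set x] by rewrite !setUid.
rewrite -[vtx i]/(SM6 t) -convex_hull1 -e.
apply: short_arc_face; last 2 first.
- exact: range_vtx_SM6.
- by move=> x [[]|] ->; exists i.
exists t, t; split => //.
  by rewrite subrr acos_ge0//; apply/andP; split; lra.
by rewrite !setUid => _ ->; exists t => //=; rewrite in_itv/= lexx.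
Qed.

Lemma regular_polytope_cs : (11 <= n)%N -> ~~ odd n ->
  cs_polytope n regular_polytope.
Proof.
move=> n11 evn; have n0 : (0 < n)%N by apply: leq_trans n11.
have sym : centrally_symmetric regular_polytope.
  by rewrite /centrally_symmetric -convex_hull_opp -range_vtx_opp.
split => //.
- by exists (range vtx) => //; exact: range_vtx_finite.
- exists 0, fullv; split; last by rewrite dimvf /dim /= mul1n.
  apply/seteqP; split => x _; first by exists x; rewrite ?add0r//= memvf.
  move=> B [[x0 [U ->]] sub].
  (* An affine subspace containing [vtx i] and [- vtx i] has half their difference, [vtx i], as a
     direction; these directions span everything. *)
  have hU i : vtx i \in U.
    have [|u Uu eu] := sub (vtx i).
      by apply: convex_hull_sub; exists i.
    have [|u' Uu' eu'] := sub (- vtx i).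
      by rewrite -vtx_opp//; apply: convex_hull_sub; exists (i + n./2)%N.
    have -> : vtx i = 2^-1 *: (u - u').
      have -> : u - u' = vtx i - - vtx i.
        by rewrite -eu' -eu opprD addrACA subrr add0r.
      rewrite opprK -mulr2n -(scaler_nat 2 (vtx i)) scalerA.
      by rewrite mulVf ?scale1r ?pnatr_eq0.
    by rewrite memvZ// memvB.
  have x0U : x0 \in U.
    have [|u Uu eu] := sub (vtx 0); first by apply: convex_hull_sub; exists 0%N.
    by rewrite -(addrK u x0) eu memvB.
  exists (x - x0); last by rewrite subrKC.
  by rewrite /= memvB//; exact: vtx_span.
- rewrite regular_polytope_vertices//.
  apply: card_eq_trans (inj_card_eq (f := vtx) (A := `I_n) _).
    rewrite (_ : range vtx = vtx @` `I_n) ?card_eqxx//.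
    apply/seteqP; split => _ [i _ <-]; last by exists i.
    by exists (i %% n)%N; [rewrite /= ltn_mod|rewrite -vtx_mod].
  by move=> i j; rewrite !inE /= => ? ? /(vtx_eq _ _ n0); rewrite !modn_small.
Qed.

End RegularPolytope.

Arguments regular_polytope : clear implicits.

(** * Counting faces *)

(** Each orbit has two elements; [A] collects the one of smaller rank, and [f] maps [A] onto its
    complement. *)
Lemma involution_fixfree_even (T : finType) (f : T -> T) :
  involutive f -> (forall x, f x != x) -> ~~ odd #|T|.
Proof.
move=> fK fx; pose A := [set x | (enum_rank x < enum_rank (f x))%N]%SET.
have -> : #|T| = #|A|.*2.
  rewrite -(cardsC A) -addnn; congr addn.
  rewrite -(card_imset A (inv_inj fK)); congr #|pred_of_set _|.
  apply/setP => x; rewrite -[x]fK mem_imset; last exact: inv_inj.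
  rewrite !inE fK -leqNgt leq_eqVlt; case: eqP => //= /val_inj /enum_rank_inj e.
  by move: (fx x); rewrite e eqxx.
by rewrite odd_double.
Qed.

Section CentrallySymmetric.
Variables (R : realType) (d : nat).
Implicit Types (P : set 'rV[R]_d).

Lemma vertices_opp P v :
  centrally_symmetric P -> vertices P v -> vertices P (- v).
Proof.
move=> symP [c [b [c0 cb vE _]]].
have memN x : P x -> P (- x) by move=> Px; rewrite symP; exists x.
exists (- c), b.
have dN x : dotp (- c) x = dotp c (- x) by rewrite dotpC !dotpNr dotpC.
split; last by exists (- v).
- by rewrite oppr_eq0.
- by move=> x /memN; rewrite dN; exact: cb.
apply/seteqP; split => x.
  move=> ->; have [Pv vb] : (P `&` [set x | dotp c x = b]) v by rewrite -vE.
  by split; [exact: memN|rewrite /= dN opprK].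
rewrite /= dN => -[/memN Px xb].
have : [set v] (- x) by rewrite vE.
by move=> /= <-; rewrite opprK.
Qed.

(** A functional supporting [P] at 0 is nonpositive at [x] and at [- x], so it vanishes on [P]. If
    it exposed only 0, then [P] would be a point. *)
Lemma vertices_neq0 P j : centrally_symmetric P -> (0 < j)%N -> has_dim P j ->
  ~ vertices P 0.
Proof.
move=> symP j0 [x0 [U [aff dimU]]] [c [b [c0 cb zE _]]].
have [P0 b0] : (P `&` [set x | dotp c x = b]) 0 by rewrite -zE.
rewrite /= dotpC dotp0l in b0; subst b.
have P00 x : P x -> x = 0.
  move=> Px; suff : [set 0] x by [].
  rewrite zE; split => //=; apply/eqP; rewrite eq_le cb//=.
  have := cb (- x); rewrite dotpNr oppr_le0; apply.
  by rewrite symP; exists x.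
have sub : translate x0 U `<=` [set 0].
  rewrite -aff; apply: affine_hull_min => //.
  exists 0, 0%VS; apply/seteqP; split => [_ ->|_ [u /= + <-]].
    by exists 0; rewrite /= ?mem0v ?addr0.
  by rewrite memv0 => /eqP ->; rewrite addr0.
have x00 : x0 = 0 by apply: sub; exists 0; rewrite /= ?mem0v ?addr0.
have U0 : U = 0%VS.
  apply/eqP; rewrite -subv0; apply/subvP => u Uu; rewrite memv0; apply/eqP.
  by apply: sub; exists u => //; rewrite x00 add0r.
by move: j0; rewrite -dimU U0 dimv0.
Qed.

(** Negation permutes the vertices without a fixed point. *)
Lemma cs_polytope_even n P : (0 < d)%N -> cs_polytope n P -> ~~ odd n.
Proof.
move=> d0 [_ dimP symP /card_esym /card_set_bijP[g [fung injg surjg]]].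
have ex (i : 'I_n) : exists j : 'I_n, g j = - g i.
  have [k kn gk] := surjg _ (vertices_opp symP (fung i (ltn_ord i))).
  by exists (Ordinal kn).
have [f fE] := choice ex.
have inj : injective (fun i : 'I_n => g i).
  by move=> i j e; apply/val_inj/injg; rewrite ?inE //=; exact: ltn_ord.
rewrite -[n]card_ord; apply: (@involution_fixfree_even _ f) => [i|i].
  by apply: inj; rewrite !fE opprK.
apply/eqP => fi; apply: (vertices_neq0 symP d0 dimP).
suff <- : g i = 0 by apply: fung; exact: ltn_ord.
have : 2 *: (g i : 'rV[R]_d) == 0 by rewrite scaler_nat mulr2n -{1}fi fE addNr.
by rewrite scaler_eq0 pnatr_eq0 => /eqP.
Qed.

End CentrallySymmetric.

(** * Triples in a window of consecutive vertices *)

Section FaceCount.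
Variables (R : realType) (n q : nat).
Hypothesis n0 : (0 < n)%N.
Hypothesis qn : (2 * q < n)%N.
Hypothesis qphi : 2 * pi * q%:R / n%:R <= acos (1 / 8) :> R.

Let v := vtx R n.

(** The pair records the first vertex of the triple and the offsets of the others; these run from 1
    to [q], hence the successor. Naming the first vertex makes each triple count once. *)
Definition window_points (p : 'I_n * {set 'I_q}) : set 'rV[R]_6 :=
  [set v p.1] `|` [set v (p.1 + i.+1) | i in [set i : 'I_q | i \in p.2]].

Lemma window_pointsE (j : 'I_n) (A : {set 'I_q}) : #|A| = 2 ->
  exists a b : 'I_q, [/\ a != b, A = [set a; b]%SET &
    window_points (j, A) = [set v j; v (j + a.+1); v (j + b.+1)]].
Proof.
move=> /eqP /cards2P[a [b [ab AE]]]; exists a, b; split => //.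
rewrite /window_points -setUA; congr setU; rewrite AE; apply/seteqP; split.
  by move=> _ [i /= + <-]; rewrite !inE => /orP[]/eqP ->; [left|right].
by move=> _ [->|->]; [exists a|exists b]; rewrite //= !inE eqxx ?orbT.
Qed.

Lemma window_arc (j : 'I_n) (a b : nat) : (a <= q)%N -> (b <= q)%N ->
  let t i := 2 * pi * i%:R / n%:R : R in
  exists x y : R, [/\ x <= y, y - x <= acos (1 / 8) &
     [set expi (t j); expi (t (j + a)%N); expi (t (j + b)%N)]
     `<=` circle_arc x y].
Proof.
move=> aq bq t; have pi0 := pi_gt0 R.
have nR : 0 < n%:R :> R by rewrite ltr0n.
have tS i k : t (i + k)%N = t i + t k by rewrite /t natrD; ring.
have t0 i : 0 <= t i by rewrite divr_ge0// !mulr_ge0// ltW.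
have tq k : (k <= q)%N -> t k <= t q.
  by move=> kq; rewrite ler_pM2r ?invr_gt0// ler_pM2l ?ler_nat// mulr_gt0.
exists (t j), (t j + t q); split.
- by rewrite lerDl.
- by rewrite addrC addKr.
- move=> _ [[->|->]|->].
  + by exists (t j) => //=; rewrite in_itv/= lexx lerDl t0.
  + by exists (t (j + a)%N) => //=; rewrite in_itv/= tS lerDl t0 lerD2l tq.
  + by exists (t (j + b)%N) => //=; rewrite in_itv/= tS lerDl t0 lerD2l tq.
Qed.

Lemma vtx_window_neq (j : nat) (a b : nat) : (a < n)%N -> (b < n)%N -> a != b ->
  v (j + a) != v (j + b).
Proof.
move=> an bn; apply: contra_neq => /(vtx_eq R _ _ n0)/eqP.
by rewrite eqn_modDl !modn_small// => /eqP.
Qed.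

Lemma window_face (p : 'I_n * {set 'I_q}) : #|p.2| = 2 ->
  faces_of_dim (regular_polytope R n) 2 (convex_hull (window_points p)).
Proof.
case: p => j A /= /(window_pointsE j)[a [b [ab _ ->]]].
have aq := ltn_ord a; have bq := ltn_ord b.
have an : (a.+1 < n)%N by lia.
have bn : (b.+1 < n)%N by lia.
have n12 : v j != v (j + a.+1).
  by rewrite -{1}[nat_of_ord j]addn0 vtx_window_neq.
have n13 : v j != v (j + b.+1).
  by rewrite -{1}[nat_of_ord j]addn0 vtx_window_neq.
have n23 : v (j + a.+1) != v (j + b.+1) by rewrite vtx_window_neq.
split.
  apply: short_arc_face; first exact: window_arc.
    exact: range_vtx_SM6.
  by move=> _ [[->|->]|->]; eexists.
by apply: short_arc_triangle; split; apply/eqP => /expi_eq/eqP; exact/negP.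
Qed.

(** The hull lies in a supporting hyperplane that meets the curve only in the triple, so the face
    determines the triple. *)
Lemma window_points_hull (p : 'I_n * {set 'I_q}) i : #|p.2| = 2 ->
  convex_hull (window_points p) (v i) -> window_points p (v i).
Proof.
case: p => j A /= /(window_pointsE j)[a [b [ab _ ->]]].
have aq := ltn_ord a; have bq := ltn_ord b.
have [c [k [_ ck cE]]] := short_arc_support (window_arc j aq bq).
have sub : convex_hull [set v j; v (j + a.+1); v (j + b.+1)] `<=`
    [set x | dotp c x = k].
  apply: convex_hull_min => [x y l /= xk yk _ _|_ [[->|->]|->]].
  - by rewrite dotpDr !dotpZr xk yk; ring.
  - by apply/cE; apply: Or31.
  - by apply/cE; apply: Or32.
  - by apply/cE; apply: Or33.
by move=> /sub/cE[] e; [left; left|left; right|right].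
Qed.

Lemma window_hull_sub (p p' : 'I_n * {set 'I_q}) : #|p'.2| = 2 ->
  convex_hull (window_points p) = convex_hull (window_points p') ->
  window_points p `<=` window_points p'.
Proof.
move=> p'2 e x px; have : convex_hull (window_points p') x.
  by rewrite -e; exact: convex_hull_sub.
by case: px => [->|[i _ <-]]; exact: window_points_hull.
Qed.

Lemma window_face_inj : {in [set p : 'I_n * {set 'I_q} | #|p.2| == 2]%SET &,
  injective (fun p => convex_hull (window_points p))}.
Proof.
move=> [j A] [j' A']; rewrite !inE /= => /eqP A2 /eqP A'2 e.
have s1 := @window_hull_sub (j, A) (j', A') A'2 e.
have s2 := @window_hull_sub (j', A') (j, A) A2 (esym e).
have jj' : j = j'.
  have /s1[/(vtx_eq R _ _ n0)|] : window_points (j, A) (v j) by left.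
    by rewrite !modn_small// => /val_inj.
  move=> [i' _ /(vtx_eq R _ _ n0) /= e1].
  have /s2[/(vtx_eq R _ _ n0)|] : window_points (j', A') (v j') by left.
    by rewrite !modn_small// => /val_inj.
  move=> [i _ /(vtx_eq R _ _ n0) /= e2].
  (* If each first vertex followed the other within its window, the two offsets would sum to a
     multiple of [n]; but the sum is positive and at most [2 * q < n]. *)
  exfalso; have : (j + (i.+1 + i'.+1))%N = (j + 0)%N %[mod n].
    by rewrite addnA -modnDml e2 modnDml e1 addn0.
  move/eqP; rewrite eqn_modDl mod0n modn_small//.
  by have := ltn_ord i; have := ltn_ord i'; lia.
subst j'; congr (_, _).
have sub (B B' : {set 'I_q}) :
    window_points (j, B) `<=` window_points (j, B') ->
    B \subset B'.
  move=> s; apply/fintype.subsetP => i Bi.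
  have iq := ltn_ord i.
  have /s[/= /eqP|[i' /= B'i' /eqP]] : window_points (j, B) (v (j + i.+1)).
  - by right; exists i.
  - by rewrite -[X in _ == v X]addn0 (negbTE (vtx_window_neq _ _ _ _))//; lia.
  - have [<-//|ii'] := eqVneq i' i.
    have i'q := ltn_ord i'.
    by rewrite (negbTE (vtx_window_neq _ _ _ _))//; lia.
by apply/eqP; rewrite finset.eqEsubset !sub.
Qed.

Lemma fmax_ge : (11 <= n)%N -> ~~ odd n -> (n * 'C(q, 2) <= fmax R 6 n 2)%N.
Proof.
move=> n11 evn; have csP := regular_polytope_cs R n11 evn.
have [k fk] := cs_polytope_faces_finite 2 csP.
apply: (@leq_trans k); last by apply: leq_fmax; exists (regular_polytope R n).
have <- : #|[set p : 'I_n * {set 'I_q} | #|p.2| == 2]%SET| = (n * 'C(q, 2))%N.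
  rewrite -[in RHS](card_ord q) -card_draws -[in RHS](card_ord n).
  rewrite -cardsT -cardsX.
  by congr #|pred_of_set _|; apply/setP => p; rewrite !inE.
apply: (fintype_le_card_eq_II window_face_inj _ fk) => p.
by rewrite inE => /eqP; exact: window_face.
Qed.

End FaceCount.

(** * From the count to the asymptotic ratio *)

Lemma binomial3_le (n : nat) : ('C(n, 3) * 6 <= n ^ 3)%N.
Proof.
have -> : (6 = 3`!)%N by [].
rewrite bin_ffact !ffactnS ffactn0 muln1 !expnS expn0 muln1.
by rewrite leq_mul// leq_mul//; lia.
Qed.

(** As [cos (pi / 2) = 0 < 1 / 8], the arc is shorter than a quarter circle; this later gives
    [2 * q < n]. *)
Lemma acos8_lt (R : realType) : 2 * acos (1 / 8) < pi :> R.
Proof.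
have b8 : -1 <= (1 / 8 : R) <= 1 by apply/andP; split; lra.
rewrite mulrC -ltr_pdivlMr// ltNge; apply/negP => h.
have pi0 := pi_gt0 R.
have : cos (acos (1 / 8)) <= cos (pi / 2) :> R.
  rewrite leNgt ltr_cos ?in_itv/= -?leNgt ?h//.
  - by rewrite acos_ge0 ?acos_lepi.
  - by apply/andP; split; lra.
by rewrite acosK ?in_itv//= cos_pihalf; lra.
Qed.

(** With [x = n kappa] and [q] its integer part, the ratio is at least [3 (x - 1) (x - 2) / n^2],
    which falls short of [3 kappa^2] by at most [9 kappa / n]. *)
Lemma fmax_ratio_ge (R : realType) (n : nat) (P : set 'rV[R]_6) :
  cs_polytope n P ->
  3 * (acos (1 / 8) / (2 * pi)) ^+ 2 - 12 * n.+1%:R^-1 <=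
  (fmax R 6 n 2)%:R / ('C(n, 3))%:R :> R.
Proof.
move=> csP; set kappa : R := acos (1 / 8) / (2 * pi).
have evn := cs_polytope_even (isT : (0 < 6)%N) csP.
have pi0 := pi_gt0 R.
have b8 : -1 <= (1 / 8 : R) < 1 by apply/andP; split; lra.
have k0 : 0 < kappa by rewrite divr_gt0 ?acos_gt0// mulr_gt0.
have k4 : kappa < 1 / 4.
  by rewrite /kappa ltr_pdivrMr ?mulr_gt0//; have := acos8_lt R; lra.
set N : R := n%:R; have N0 : 0 <= N by exact: ler0n.
have [small|large] := ltP (N * kappa) 3.
  (* For [n kappa < 3] the left side is already nonpositive. The quotient is nonnegative also where
     the binomial is 0, since division by 0 gives 0. *)
  apply: (@le_trans _ _ 0); last by rewrite divr_ge0.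
  rewrite subr_le0 ler_pdivlMr; last exact: ltr0Sn.
  rewrite -(natr1 n) -/N mulrDr mulr1.
  by move: small k0 k4 N0; move: (kappa) (N) => k M; clear; nra.
(* From [n kappa >= 3] and [kappa < 1 / 4]; this secures [11 <= n] for the regular polytope. *)
have N12 : 12 < N by move: large k0 k4 N0; move: (kappa) (N) => k M; clear; nra.
have n12 : (12 < n)%N by rewrite -(ltr_nat R).
have n0 : (0 < n)%N by apply: leq_trans n12.
set x := N * kappa; pose q := Num.truncn x.
have x0 : 0 <= x by rewrite /x mulr_ge0// ltW.
have /andP[qx xq] : q%:R <= x < q.+1%:R by exact: truncn_itv.
have N0' : 0 < N by rewrite ltr0n.
have qn : (2 * q < n)%N.
  rewrite -(ltr_nat R) natrM -/N; apply: (@le_lt_trans _ _ (2 * x)).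
    by rewrite ler_pM2l.
  by rewrite /x; move: k4 N0'; move: (kappa) (N) => k M; clear; nra.
have qphi : 2 * pi * q%:R / n%:R <= acos (1 / 8) :> R.
  rewrite -/N ler_pdivrMr// mulrC -ler_pdivlMr ?mulr_gt0// mulrAC.
  by rewrite mulrC.
have := fmax_ge n0 qn qphi (ltnW (ltnW n12)) evn.
set F := fmax R 6 n 2 => hF.
have hC : 0 < ('C(n, 3))%:R :> R by rewrite ltr0n bin_gt0 (leq_trans _ n12).
have hC' : ('C(n, 3))%:R * 6 <= N ^+ 3.
  by rewrite -natrM -natrX ler_nat binomial3_le.
have F2 : N * ((x - 1) * (x - 2)) <= 2 * F%:R.
  have q1 : x - 1 <= q%:R by move: xq; rewrite -(natr1 q); lra.
  have q3 : (2 <= q)%N.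
    by apply: ltnW; rewrite -ltnS -(ltr_nat R) (le_lt_trans large).
  have qE : (2 * 'C(q, 2))%:R = q%:R * (q%:R - 1) :> R.
    rewrite bin2 mul2n halfK.
    case: q q3 {qx xq qn qphi hF q1} => // q _.
    by rewrite oddM /= andNb subn0 natrM -(natr1 q) addrK.
  apply: (@le_trans _ _ (N * (2 * 'C(q, 2))%:R)).
    rewrite ler_pM2l// qE; move: large q1; rewrite -/x; clear; move=> large q1.
    by apply: ler_pM; lra.
  rewrite natrM mulrCA ler_pM2l// -natrM ler_nat.
  exact: hF.
rewrite ler_pdivlMr//.
apply: (@le_trans _ _ (3 * ((x - 1) * (x - 2)) / N ^+ 2 * ('C(n, 3))%:R)).
  rewrite ler_pM2r// ler_pdivlMr ?exprn_gt0// mulrBl.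
  have -> : 3 * kappa ^+ 2 * N ^+ 2 = 3 * x ^+ 2 by rewrite /x; ring.
  have xN : x <= N / 4.
    by rewrite /x; move: k4 N0'; move: (kappa) (N) => k M; clear; nra.
  (* The loss [3 x^2 - 3 (x - 1) (x - 2) = 9 x - 6] is at most [9 n / 4], because [x <= n / 4]. *)
  suff : 9 / 4 * N <= 12 * n.+1%:R^-1 * N ^+ 2.
    by move: xN; move: (x) (N) (12 / n.+1%:R * N ^+ 2) => y M w; clear; lra.
  rewrite [leRHS]mulrAC ler_pdivlMr; last exact: ltr0Sn.
  rewrite -(natr1 n) -/N.
  by move: N12; move: (N) => M; clear; nra.
have S0 : 0 <= (x - 1) * (x - 2).
  by move: large; rewrite -/x => x3; rewrite mulr_ge0 ?subr_ge0; lra.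
move: S0 F2; set S := (x - 1) * (x - 2) => S0 F2.
apply: (@le_trans _ _ (S / N ^+ 2 / 2 * (('C(n, 3))%:R * 6))).
  by rewrite le_eqVlt; apply/orP; left; apply/eqP; field; rewrite gt_eqF.
apply: (@le_trans _ _ (S / N ^+ 2 / 2 * N ^+ 3)).
  by rewrite ler_wpM2l// !divr_ge0// exprn_ge0.
have -> : S / N ^+ 2 / 2 * N ^+ 3 = N * S / 2 by field; rewrite gt_eqF.
by lra.
Qed.

Theorem theorem7p2 (R : realType) :
  (forall t1 t2 t3 : R,
     [/\ expi t1 != expi t2, expi t1 != expi t3 & expi t2 != expi t3] ->
     (exists a b : R,
        [/\ a <= b, b - a <= acos (1 / 8) &
            [set expi t1; expi t2; expi t3] `<=` circle_arc a b]) ->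
     let T := convex_hull [set SM6 t1; SM6 t2; SM6 t3] in
     is_face (B6 R) T /\ has_dim T 2)
  /\
  (exists2 e : R^nat, e @ \oo --> (0 : R) &
     forall n : nat, (exists P : set 'rV[R]_6, cs_polytope n P) ->
       (fmax R 6 n 2)%:R / ('C(n, 3))%:R >=
         3 * (acos (1 / 8) / (2 * pi)) ^+ 2 + e n).
Proof.
split=> [t1 t2 t3 dist arc T|].
  split; last exact: short_arc_triangle.
  by apply: short_arc_face => // _ [[->|->]|->]; eexists.
(* [harmonic n] is [1 / (n + 1)], so the error term is defined at [n = 0] as well. *)
exists (fun n => - 12 * harmonic n).
  by rewrite -[X in _ --> X](mulr0 (- 12)); apply: cvgMr; exact: cvg_harmonic.
by move=> n [P csP]; rewrite mulNr; exact: fmax_ratio_ge csP.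
Qed.
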